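(* Let $(M,g)$ be a pseudo-Riemannian manifold with Levi-Civita connection $\nabla^g$, Ricci tensor $\mathrm{Ric}$ and scalar curvature $\mathrm{scal}$. Let $f$ be a smooth function on $M$ and $\lambda$ a real constant. Assume that $\mathrm{Hess}(f)$ is a pseudo-Riemannian metric (non-degenerate of constant signature), and in (i) and (ii) that $\mathrm{Ric}$ is a pseudo-Riemannian metric as well. (i) If $\mathrm{Hess}(f)+\mathrm{Ric}=\lambda g$ (gradient Ricci soliton), then $(\mathrm{Hess}(f),\nabla^g)$ is a statistical structure on $M$ if and only if $(\mathrm{Ric},\nabla^g)$ is a statistical structure on $M$. (ii) If $\mathrm{Hess}(f)+\mathrm{Ric}=\left(\lambda+\frac{\mathrm{scal}}{2}\right)g$ (gradient Einstein soliton) and $\mathrm{scal}$ is constant, then $(\mathrm{Hess}(f),\nabla^g)$ is a statistical structure on $M$ if and only if $(\mathrm{Ric},\nabla^g)$ is a statistical structure on $M$. (iii) If $\mathrm{Hess}(f)=(\lambda-\mathrm{scal})g$ (gradient Yamabe soliton) and $\mathrm{scal}$ is constant, then $(\mathrm{Hess}(f),\nabla^g)$ is a statistical structure on $M$.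
   Context: A statistical structure on a smooth manifold $M$ is a pair $(h,\nabla)$ where $h$ is a pseudo-Riemannian metric, $\nabla$ is a torsion-free affine connection, and $(\nabla_X h)(Y,Z)=(\nabla_Y h)(X,Z)$ for all $X,Y,Z\in\mathfrak{X}(M)$. $\mathrm{Hess}(f)(X,Y)=g(\nabla^g_X\nabla f,Y)$, where $\nabla f$ is the $g$-gradient of $f$. *)

(* Defs.v *)
(* Smooth manifolds and semi-Riemannian geometry over a realType, on top of
   MathComp-Analysis.  Vector fields are the derivations of the algebra of
   smooth functions, tensor fields of type (0,2) are the bilinear maps over
   that algebra, and pointwise notions (frames, traces, signature) are
   expressed by evaluating at a point. *)
From HB Require Import structures.
From mathcomp Require Import all_boot all_order all_algebra.
From mathcomp Require Import all_classical all_reals all_analysis.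
Set Implicit Arguments.
Unset Strict Implicit.
Unset Printing Implicit Defensive.
Import Order.TTheory GRing.Theory Num.Theory.
Import numFieldNormedType.Exports.
Local Open Scope classical_set_scope.
Local Open Scope ring_scope.

Section SmoothRn.
Context {R : realType} {n : nat}.
Implicit Types (U : set 'rV[R]_n) (f g : 'rV[R]_n -> R).

Fixpoint Ck (k : nat) U f : Prop :=
  (forall x, U x -> {for x, continuous f}) /\
  if k is k'.+1 then
    forall i : 'I_n, (forall x, U x -> derivable f x (delta_mx 0 i)) /\
                     Ck k' U (fun x => 'D_(delta_mx 0 i) f x)
  else True.

Definition smooth_on U f := forall k, Ck k U f.

Lemma Ck_ext k U f g : open U -> (forall x, U x -> f x = g x) ->
  Ck k U f -> Ck k U g.
Proof.
move=> oU; have nearfg f' g' : (forall x, U x -> f' x = g' x) ->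
    forall x, U x -> {near x, f' =1 g'}.
  move=> fg x Ux; near=> y; apply: fg; near: y; exact: open_nbhs_nbhs.
have cont f' g' : (forall x, U x -> f' x = g' x) ->
    (forall x, U x -> {for x, continuous f'}) ->
    forall x, U x -> {for x, continuous g'}.
  move=> fg cf x Ux; change (g' @ x --> g' x); rewrite -(fg _ Ux).
  apply: cvg_trans (cf x Ux); apply: (@near_eq_cvg _ _ (nbhs x)).
  exact: nearfg.
elim: k f g => [|k IH] f g fg /= [cf df]; split=> //; try exact: cont fg cf.
move=> i; have [dfi ckf] := df i; split.
  by move=> x Ux; exact: near_eq_derivable (nearfg _ _ fg x Ux) (dfi x Ux).
by apply: IH ckf => x Ux; apply: near_eq_derive; exact: nearfg.
Unshelve. all: by end_near.
Qed.

Lemma Ck_pred k U f : Ck k.+1 U f -> Ck k U f.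
Proof.
elim: k f => [|k IH] f /= [cf df]; split=> // i.
by have [dfi ckf] := df i; split=> //; apply: IH.
Qed.

Lemma Ck_cst k U (c : R) : open U -> Ck k U (fun=> c).
Proof.
move=> oU; elim: k c => [|k IH] c /=; split=> //; try by move=> x _; exact: cst_continuous.
move=> i; split; first by move=> x _; exact: derivable_cst.
by apply: Ck_ext (IH 0) => // x _; rewrite derive_cst.
Qed.

Lemma CkD k U f g : open U -> Ck k U f -> Ck k U g ->
  Ck k U (fun x => f x + g x).
Proof.
move=> oU; elim: k f g => [|k IH] f g /= [cf df] [cg dg]; split=> //;
  try by move=> x Ux; apply: continuousD; [exact: cf|exact: cg].
move=> i; have [dfi ckf] := df i; have [dgi ckg] := dg i; split.
  by move=> x Ux; apply: derivableD; [exact: dfi|exact: dgi].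
apply: Ck_ext (IH _ _ ckf ckg) => // x Ux.
by rewrite deriveD //; [exact: dfi|exact: dgi].
Qed.

Lemma CkM k U f g : open U -> Ck k U f -> Ck k U g ->
  Ck k U (fun x => f x * g x).
Proof.
move=> oU; elim: k f g => [|k IH] f g Cf Cg.
  move: Cf Cg => /= [cf _] [cg _]; split=> // x Ux.
  by apply: continuousM; [exact: cf|exact: cg].
have Cf' := Ck_pred Cf; have Cg' := Ck_pred Cg.
move: Cf Cg => /= [cf df] [cg dg]; split.
  by move=> x Ux; apply: continuousM; [exact: cf|exact: cg].
move=> i; have [dfi ckf] := df i; have [dgi ckg] := dg i; split.
  by move=> x Ux; apply: derivableM; [exact: dfi|exact: dgi].
apply: Ck_ext (CkD oU (IH _ _ Cf' ckg) (IH _ _ Cg' ckf)) => // x Ux.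
by rewrite deriveM //; [exact: dfi|exact: dgi].
Qed.

End SmoothRn.

Record chart (R : realType) (n : nat) (M : topologicalType) := Chart {
  chart_dom : set M;
  chart_map : M -> 'rV[R]_n;
  chart_inv : 'rV[R]_n -> M; (* only relevant on the image of [chart_dom] *)
  chart_dom_open : open chart_dom;
  chart_img_open : open (chart_map @` chart_dom);
  chart_mapK : forall p, chart_dom p -> chart_inv (chart_map p) = p;
  chart_map_continuous : {within chart_dom, continuous chart_map};
  chart_inv_continuous :
    {within chart_map @` chart_dom, continuous chart_inv} }.

Definition transition_smooth (R : realType) n (M : topologicalType)
    (c c' : chart R n M) :=
  forall i : 'I_n,
    smooth_on (chart_map c @` (chart_dom c `&` chart_dom c'))
              (fun x => chart_map c' (chart_inv c x) 0 i).

(* Real smooth n-manifolds without boundary; the smooth structure is given by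
   an atlas that need not be maximal. *)
Record smoothManifold (R : realType) (n : nat) := SmoothManifold {
  mfd_space :> topologicalType;
  mfd_hausdorff : hausdorff_space mfd_space;
  mfd_second_countable : @second_countable mfd_space;
  mfd_atlas : set (chart R n mfd_space);
  mfd_cover : forall p : mfd_space, exists2 c, mfd_atlas c & chart_dom c p;
  mfd_compat : forall c c', mfd_atlas c -> mfd_atlas c' ->
    transition_smooth c c' }.

Section SmoothFunctions.
Context {R : realType} {n : nat}.
Variable M : smoothManifold R n.

Definition smooth (f : M -> R) : Prop :=
  forall c, mfd_atlas c ->
    smooth_on (chart_map c @` chart_dom c) (fun x => f (chart_inv c x)).

Definition smooth_pred : {pred M -> R} := fun f => `[< smooth f >].

Lemma smooth_subring : subring_closed smooth_pred.
Proof.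
have oimg (c : chart R n M) : open (chart_map c @` chart_dom c).
  exact: chart_img_open.
split=> [|f g /asboolP Sf /asboolP Sg|f g /asboolP Sf /asboolP Sg];
  apply/asboolP => c Ac k.
- exact: (Ck_cst k 1 (oimg c)).
- have C := CkM (oimg c) (Ck_cst k (-1) (oimg c)) (Sg c Ac k).
  apply: Ck_ext (CkD (oimg c) (Sf c Ac k) C) => // x _.
  by rewrite mulN1r.
- exact: CkM (oimg c) (Sf c Ac k) (Sg c Ac k).
Qed.

Lemma smooth_submod : submod_closed smooth_pred.
Proof.
have oimg (c : chart R n M) : open (chart_map c @` chart_dom c).
  exact: chart_img_open.
split=> [|a f g /asboolP Sf /asboolP Sg]; apply/asboolP => c Ac k.
  exact: (Ck_cst k 0 (oimg c)).
exact: CkD (oimg c) (CkM (oimg c) (Ck_cst k a (oimg c)) (Sf c Ac k))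
  (Sg c Ac k).
Qed.

HB.instance Definition _ :=
  GRing.isSubringClosed.Build (M -> R) smooth_pred smooth_subring.
HB.instance Definition _ :=
  GRing.isSubmodClosed.Build R (M -> R) smooth_pred smooth_submod.

Record cinf := Cinf { cinf_fun :> M -> R; _ : cinf_fun \in smooth_pred }.

HB.instance Definition _ := [isSub for cinf_fun].
HB.instance Definition _ := [Choice of cinf by <:].
HB.instance Definition _ := 
  GRing.SubChoice_isSubComPzRing.Build (M -> R) smooth_pred cinf
    (subringClosedP _).
HB.instance Definition _ := [SubZmodule_isSubLmodule of cinf by <:].

Definition derivation (X : cinf -> cinf^o) : Prop :=
  [/\ forall u v, X (u + v) = X u + X v,
      forall (a : R) u, X (a *: u) = (a *: X u : cinf) &
      forall u v, X (u * v) = X u * v + u * X v].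

Definition derivation_pred : {pred cinf -> cinf^o} :=
  fun X => `[< derivation X >].

Lemma derivation_submod : submod_closed derivation_pred.
Proof.
split=> [|a X Y /asboolP [XD XZ XM] /asboolP [YD YZ YM]]; apply/asboolP.
  split=> [u v|c u|u v] /=; first by rewrite addr0.
    by change (0 = c *: 0 :> cinf); rewrite scaler0.
  by change (0 = 0 * v + u * 0 :> cinf); rewrite mul0r mulr0 addr0.
have E u : (a *: X + Y) u = a * X u + Y u :> cinf by [].
split=> [u v|c u|u v]; rewrite !E.
- by rewrite XD YD mulrDr addrACA.
- rewrite XZ YZ scalerDr; congr (_ + _); apply: val_inj; apply/funext => p.
  exact: mulrCA.
- rewrite XM YM !mulrDr !mulrDl !mulrA addrACA.
  by rewrite (mulrC u a).
Qed.

HB.instance Definition _ :=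
  GRing.isSubmodClosed.Build cinf (cinf -> cinf^o) derivation_pred
    derivation_submod.

Record vf := Vf { vf_fun : cinf -> cinf^o; _ : vf_fun \in derivation_pred }.

HB.instance Definition _ := [isSub for vf_fun].
HB.instance Definition _ := [Choice of vf by <:].
HB.instance Definition _ := [SubChoice_isSubZmodule of vf by <:].
HB.instance Definition _ := [SubZmodule_isSubLmodule of vf by <:].

(* [vf_fun] lands in [cinf^o] so that [vf] inherits a [cinf]-module structure;
   [vf_app] forgets the [^o], so that [a *: X f] for [a : R] is meaningful. *)
Definition vf_app (X : vf) : cinf -> cinf := vf_fun X.

Lemma vf_derivation (X : vf) : derivation (vf_app X).
Proof. by case: X => X /= /asboolP. Qed.

Lemma bracket_subproof (X Y : vf) :
  (fun f => vf_app X (vf_app Y f) - vf_app Y (vf_app X f) : cinf^o)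
    \in derivation_pred.
Proof.
have [XD XZ XM] := vf_derivation X; have [YD YZ YM] := vf_derivation Y.
apply/asboolP; split=> [u v|c u|u v].
- by rewrite XD YD XD YD opprD addrACA.
- by rewrite XZ YZ XZ YZ -scalerBr.
- rewrite XM YM XD YD !XM !YM mulrBl mulrBr.
  have E (V : zmodType) (a b c d e k : V) :
      (a + b) + (c + d) - ((e + c) + (b + k)) = a - e + (d - k).
    rewrite [a + b]addrC [_ + (c + d)]addrACA [e + c]addrC.
    rewrite [_ + (b + k)]addrACA [c + b]addrC opprD.
    by rewrite [LHS]addrACA subrr add0r opprD [LHS]addrACA.
  exact: E.
Qed.

Definition bracket (X Y : vf) : vf := Vf (bracket_subproof X Y).

End SmoothFunctions.

Coercion vf_app : vf >-> Funclass.

Section Geometry.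
Context {R : realType} {n : nat} {M : smoothManifold R n}.
Implicit Types (X Y Z : vf M) (f : cinf M) (p : M).
Implicit Types (h g : vf M -> vf M -> cinf M) (D : vf M -> vf M -> vf M).

(* Elements of the tangent space at [p]. *)
Definition point_derivation p (v : cinf M -> R) : Prop :=
  [/\ forall u w, v (u + w) = v u + v w,
      forall (a : R) u, v (a *: u) = a * v u &
      forall u w, v (u * w) = v u * w p + u p * v w].

(* The values at [p] of the fields [E i] form a basis of the tangent space. *)
Definition frame_at p (E : 'I_n -> vf M) : Prop :=
  forall v, point_derivation p v ->
    exists! c : 'rV[R]_n, forall f, v f = \sum_i c 0 i * E i f p.

(* [t] is the pointwise trace of the endomorphism field [A]. *)
Definition is_trace (A : vf M -> vf M) (t : cinf M) : Prop :=
  forall p E (a : 'M[R]_n), frame_at p E ->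
    (forall i f, A (E i) f p = \sum_j a i j * E j f p) -> t p = \tr a.

Definition bilinear_field h : Prop :=
  (forall (a : cinf M) X X' Y, h (a *: X + X') Y = a * h X Y + h X' Y) /\
  (forall (a : cinf M) X Y Y', h X (a *: Y + Y') = a * h X Y + h X Y').

Definition symmetric_field h : Prop := forall X Y, h X Y = h Y X.

(* Every tangent vector at [p] extends to a global vector field, so
   nondegeneracy at [p] can be tested on vector fields. *)
Definition nondegenerate_field h : Prop :=
  forall p X, (forall Y, h X Y p = 0) -> forall f, X f p = 0.

Definition constant_signature h : Prop :=
  exists r : nat, forall p, exists2 E, frame_at p E &
    forall i j : 'I_n,
      h (E i) (E j) p = if i == j then (if (i < r)%N then 1 else -1) else 0.

Definition pseudo_riemannian_metric h : Prop :=
  [/\ bilinear_field h, symmetric_field h, nondegenerate_field h &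
      constant_signature h].

Definition affine_connection D : Prop :=
  [/\ forall (a : cinf M) X X' Y, D (a *: X + X') Y = a *: D X Y + D X' Y,
      forall X Y Z, D X (Y + Z) = D X Y + D X Z &
      forall (a : cinf M) X Y, D X (a *: Y) = X a *: Y + a *: D X Y].

Definition torsion_free D : Prop :=
  forall X Y, D X Y - D Y X = bracket X Y.

Definition cov_der D X h Y Z : cinf M :=
  X (h Y Z) - h (D X Y) Z - h Y (D X Z).

Definition levi_civita g D : Prop :=
  [/\ affine_connection D, torsion_free D &
      forall X Y Z, cov_der D X g Y Z = 0].

Definition curvature D X Y Z : vf M :=
  D X (D Y Z) - D Y (D X Z) - D (bracket X Y) Z.

Definition ricci_tensor D (Ric : vf M -> vf M -> cinf M) : Prop :=
  forall Y Z, is_trace (fun X => curvature D X Y Z) (Ric Y Z).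

(* In a frame, the scalar curvature is $g^{ij} Ric_{ij}$. *)
Definition scalar_curvature g (Ric : vf M -> vf M -> cinf M) (scal : cinf M) :
    Prop :=
  forall p E, frame_at p E ->
    scal p = \tr (invmx (\matrix_(i, j) g (E i) (E j) p) *m
                  \matrix_(i, j) Ric (E i) (E j) p).

Definition is_gradient g f (gradf : vf M) : Prop :=
  forall X, g gradf X = X f.

(* The Hessian of the function whose gradient is [gradf]. *)
Definition Hess g D (gradf : vf M) X Y : cinf M := g (D X gradf) Y.

Definition statistical_structure h D : Prop :=
  [/\ pseudo_riemannian_metric h, affine_connection D, torsion_free D &
      forall X Y Z, cov_der D X h Y Z = cov_der D Y h X Z].

Definition constant_function f : Prop := exists c : R, forall p, f p = c.

End Geometry.

(* Main.v *)
(* A Levi-Civita connection makes [g] parallel, and the covariant derivative of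
   a field of type (0,2) is linear over the real scalars.  When [scal] is
   constant, the first two soliton equations present each of [Hess f] and [Ric]
   as a real combination of the other one and of [g], so that the total symmetry
   of the covariant derivative passes from one to the other; the third makes
   [Hess f] a real multiple of [g], hence parallel. *)
Require Import Defs.
From mathcomp Require Import all_boot all_order all_algebra.
From mathcomp Require Import all_classical all_reals all_analysis.
From mathcomp Require Import ring.
Import Order.TTheory GRing.Theory Num.Theory.
Import numFieldNormedType.Exports.
Local Open Scope ring_scope.

Set Implicit Arguments.
Unset Strict Implicit.

(** As [a] and [c] are real constants, the derivation [X] commutes with them and no derivative of a
    coefficient appears. *)
Lemma cov_derE (R : realType) (n : nat) (M : smoothManifold R n)
    (D : vf M -> vf M -> vf M) (h k g : vf M -> vf M -> cinf M) (a c : R) :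
  (forall X Y p, h X Y p = a * k X Y p + c * g X Y p) ->
  forall X Y Z p, cov_der D X h Y Z p
    = a * cov_der D X k Y Z p + c * cov_der D X g Y Z p.
Proof.
move=> hE X Y Z p; have [XD XZ _] := vf_derivation X.
have -> : cov_der D X h Y Z p
    = X (h Y Z) p - h (D X Y) Z p - h Y (D X Z) p by [].
(* [X] acts on functions, so the pointwise hypothesis is first lifted to an equality in [cinf M]. *)
have -> : h Y Z = a *: k Y Z + c *: g Y Z.
  by apply: val_inj; apply/funext => q; exact: hE.
rewrite XD !XZ !hE.
change (a * X (k Y Z) p + c * X (g Y Z) p
  - (a * k (D X Y) Z p + c * g (D X Y) Z p)
  - (a * k Y (D X Z) p + c * g Y (D X Z) p)
  = a * (X (k Y Z) p - k (D X Y) Z p - k Y (D X Z) p)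
  + c * (X (g Y Z) p - g (D X Y) Z p - g Y (D X Z) p)).
ring.
Qed.

(** The [g] term drops out because [g] is parallel, leaving [a] times the symmetric derivative of
    [k]. *)
Lemma statistical_combination (R : realType) (n : nat) (M : smoothManifold R n)
    (D : vf M -> vf M -> vf M) (h k g : vf M -> vf M -> cinf M) (a c : R) :
  levi_civita g D -> pseudo_riemannian_metric h ->
  (forall X Y p, h X Y p = a * k X Y p + c * g X Y p) ->
  (forall X Y Z, cov_der D X k Y Z = cov_der D Y k X Z) ->
  statistical_structure h D.
Proof.
move=> [connD tfD gD] hh hE kC; split=> // X Y Z.
apply: val_inj; apply/funext => p.
by rewrite [LHS](cov_derE D hE) [RHS](cov_derE D hE) !gD kC.
Qed.

Lemma statistical_sum_iff (R : realType) (n : nat) (M : smoothManifold R n)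
    (D : vf M -> vf M -> vf M) (h k g : vf M -> vf M -> cinf M) (c : R) :
  levi_civita g D ->
  pseudo_riemannian_metric h -> pseudo_riemannian_metric k ->
  (forall X Y p, h X Y p + k X Y p = c * g X Y p) ->
  statistical_structure h D <-> statistical_structure k D.
Proof.
move=> LC hh kk hkE; split=> -[_ _ _ C].
(* Each field is [c] times [g] minus the other, hence the coefficient [-1] both ways. *)
- apply: (statistical_combination (a := -1) (c := c) LC kk _ C) => X Y p.
  by rewrite -hkE; ring.
- apply: (statistical_combination (a := -1) (c := c) LC hh _ C) => X Y p.
  by rewrite -hkE; ring.
Qed.

Unset Implicit Arguments.
Set Strict Implicit.

Theorem proposition2p3 (R : realType) (n : nat) (M : smoothManifold R n)
    (g : vf M -> vf M -> cinf M) (nabla : vf M -> vf M -> vf M)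
    (Ric : vf M -> vf M -> cinf M) (scal : cinf M)
    (f : cinf M) (gradf : vf M) (lambda : R) :
  pseudo_riemannian_metric g ->
  levi_civita g nabla ->
  ricci_tensor nabla Ric ->
  scalar_curvature g Ric scal ->
  is_gradient g f gradf ->
  pseudo_riemannian_metric (Hess g nabla gradf) ->
  (pseudo_riemannian_metric Ric ->
   (forall (X Y : vf M) (p : M),
      Hess g nabla gradf X Y p + Ric X Y p = lambda * g X Y p) ->
   (statistical_structure (Hess g nabla gradf) nabla <->
    statistical_structure Ric nabla)) /\
  (pseudo_riemannian_metric Ric ->
   (forall (X Y : vf M) (p : M),
      Hess g nabla gradf X Y p + Ric X Y p =
      (lambda + scal p / 2) * g X Y p) ->
   constant_function scal ->
   (statistical_structure (Hess g nabla gradf) nabla <->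
    statistical_structure Ric nabla)) /\
  ((forall (X Y : vf M) (p : M),
      Hess g nabla gradf X Y p = (lambda - scal p) * g X Y p) ->
   constant_function scal ->
   statistical_structure (Hess g nabla gradf) nabla).
Proof.
move=> _ LC _ _ _ hess; have [_ _ gD] := LC; split; [|split].
- by move=> ric E; exact: statistical_sum_iff LC hess ric E.
- move=> ric E [c sc].
  apply: (statistical_sum_iff (c := lambda + c / 2) LC hess ric) => X Y p.
  by rewrite E sc.
- move=> E [c sc].
  (* With [a := 0] the field [k] is a placeholder; [g] serves since both its derivatives vanish. *)
  apply: (statistical_combination (k := g) (a := 0) (c := lambda - c) LC hess).
    by move=> X Y p; rewrite E sc mul0r add0r.
  by move=> X Y Z; rewrite !gD.
Qed.
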